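(* Let $(E,f)$ be a polymatroid with $f(E)>0$ and let $g(A)=2f(E)f(A)-f(A)^2$ for $A\subseteq E$ (its flag polymatroid). Then the base polytope $B_g$ is normally equivalent to the nestohedron $\sum_{S\in\mathcal{U}(f),\,S\neq\emptyset} y_S\Delta_S$ (for any positive coefficients $y_S>0$) of the building set $\mathcal{U}(f)=\{E\setminus F: F\text{ a flat of }f\}$. In particular, $B_g$ is a simple polytope.
   Context: A polymatroid: $f:2^E\to\mathbb{R}_{\ge0}$, $f(\emptyset)=0$, $f(A)\le f(A\cup B)\le f(A)+f(B)-f(A\cap B)$. $P_f=\{x\in\mathbb{R}^E:x\ge0,\sum_{e\in A}x_e\le f(A)\ \forall A\}$, $B_f=\{x\in P_f:\sum_e x_e=f(E)\}$; $g$ is again a polymatroid. A flat of $f$ is $F\subseteq E$ with $f(F\cup\{e\})>f(F)$ for all $e\in E\setminus F$. A building set is a nonempty $\mathcal{B}\subseteq 2^E$ such that $S,T\in\mathcal{B}$, $S\cap T\ne\emptyset$ imply $S\cup T\in\mathcal{B}$ (any union-closed family is one). For nonempty $S\subseteq E$, $\Delta_S=\mathrm{conv}\{e_s:s\in S\}$. Normally equivalent: same normal fan. *)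

(* Defs.v *)
From mathcomp Require Export all_boot all_order all_algebra.
From mathcomp Require Export boolp classical_sets cardinality reals.

Set Implicit Arguments.
Unset Strict Implicit.
Unset Printing Implicit Defensive.

Export Order.TTheory GRing.Theory Num.Theory.
Open Scope ring_scope.

(* R^E as a finite-dimensional vector space; R^o is R viewed as a module over
   itself.  {set E} is a finite subset of E, whereas set (vec R E) is an
   arbitrary (Prop-valued) set of points. *)
Notation vec R E := {ffun E -> R^o}.

Definition dot (R : realType) (E : finType) (w x : vec R E) : R :=
  \sum_(e : E) (w e : R) * (x e : R).

Definition std_basis (R : realType) (E : finType) (s : E) : vec R E :=
  [ffun e => (e == s)%:R].

Definition polymatroid (R : realType) (E : finType) (f : {set E} -> R) : Prop :=
  [/\ forall A, 0 <= f A,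
      f finset.set0 = 0,
      forall A B, f A <= f (A :|: B) &
      forall A B, f (A :|: B) <= f A + f B - f (A :&: B)].

Definition independence_polytope (R : realType) (E : finType)
    (f : {set E} -> R) : set (vec R E) :=
  [set x : vec R E | (forall e, 0 <= (x e : R)) /\
                     (forall A : {set E}, \sum_(e in A) (x e : R) <= f A)]%classic.

Definition base_polytope (R : realType) (E : finType)
    (f : {set E} -> R) : set (vec R E) :=
  [set x : vec R E | independence_polytope f x /\
                     \sum_(e : E) (x e : R) = f [set: E]%SET]%classic.

Definition flag_polymatroid (R : realType) (E : finType) (f : {set E} -> R)
    (A : {set E}) : R :=
  2 * f [set: E]%SET * f A - f A ^+ 2.

Definition flat (R : realType) (E : finType) (f : {set E} -> R)
    (F : {set E}) : bool :=
  [forall (e | e \notin F), f F < f (F :|: [set e]%SET)].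

Definition flat_complements (R : realType) (E : finType) (f : {set E} -> R) :
    {set {set E}} :=
  [set ~: F | F : {set E} & flat f F]%SET.

Definition building_set (E : finType) (B : {set {set E}}) : Prop :=
  B != finset.set0 /\
  forall S T : {set E}, S \in B -> T \in B ->
    S :&: T != finset.set0 -> S :|: T \in B.

Definition conv (R : realType) (E : finType) (X : set (vec R E)) :
    set (vec R E) :=
  [set x : vec R E | exists (n : nat) (p : 'I_n -> vec R E) (c : 'I_n -> R),
     [/\ forall i, X (p i), forall i, 0 <= c i, \sum_(i < n) c i = 1 &
         x = \sum_(i < n) c i *: p i]]%classic.

Definition simplex (R : realType) (E : finType) (S : {set E}) :
    set (vec R E) :=
  conv [set x : vec R E | exists2 s : E, s \in S & x = @std_basis R E s]%classic.

Definition dilate (R : realType) (E : finType) (a : R) (X : set (vec R E)) :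
    set (vec R E) :=
  [set x : vec R E | exists2 z : vec R E, X z & x = a *: z]%classic.

(* The empty Minkowski sum is the origin. *)
Definition minkowski_sum (R : realType) (E I : finType) (P : pred I)
    (X : I -> set (vec R E)) : set (vec R E) :=
  [set x : vec R E | exists2 z : I -> vec R E,
     (forall i, P i -> X i (z i)) & x = \sum_(i | P i) z i]%classic.

Definition nestohedron (R : realType) (E : finType) (B : {set {set E}})
    (y : {set E} -> R) : set (vec R E) :=
  minkowski_sum (fun S : {set E} => (S \in B) && (S != finset.set0))
    (fun S => dilate (y S) (@simplex R E S)).

Definition max_face (R : realType) (E : finType) (P : set (vec R E))
    (w : vec R E) : set (vec R E) :=
  [set x : vec R E | P x /\ forall z, P z -> dot w z <= dot w x]%classic.

(* P itself is the face maximizing w = 0; the empty face is excluded. *)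
Definition face (R : realType) (E : finType) (P F : set (vec R E)) : Prop :=
  (F !=set0)%classic /\ exists w : vec R E, F = max_face P w.

(* Outer normals: the functionals maximized on P at every point of F. *)
Definition normal_cone (R : realType) (E : finType) (P F : set (vec R E)) :
    set (vec R E) :=
  [set w : vec R E | forall x, F x -> forall z, P z -> dot w z <= dot w x]%classic.

Definition normal_fan (R : realType) (E : finType) (P : set (vec R E)) :
    set (set (vec R E)) :=
  [set N : set (vec R E) | exists2 F, face P F & N = normal_cone P F]%classic.

Definition normally_equivalent (R : realType) (E : finType)
    (P Q : set (vec R E)) : Prop :=
  normal_fan P = normal_fan Q.

(* P is nonempty and its affine hull, which is x0 + U, has dimension d. *)
Definition has_dim (R : realType) (E : finType) (P : set (vec R E))
    (d : nat) : Prop :=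
  exists (x0 : vec R E) (U : {vspace vec R E}),
    [/\ P x0,
        forall x, P x -> x - x0 \in U,
        forall W : {vspace vec R E},
          (forall x, P x -> x - x0 \in W) -> (U <= W)%VS &
        \dim U = d].

Definition vertex (R : realType) (E : finType) (P : set (vec R E))
    (v : vec R E) : Prop :=
  face P [set v]%classic.

Definition facet (R : realType) (E : finType) (P F : set (vec R E)) : Prop :=
  face P F /\ exists d : nat, has_dim P d.+1 /\ has_dim F d.

Definition polytope (R : realType) (E : finType) (P : set (vec R E)) : Prop :=
  exists s : seq (vec R E), P = conv [set x : vec R E | x \in s]%classic.

Definition simple_polytope (R : realType) (E : finType)
    (P : set (vec R E)) : Prop :=
  polytope P /\
  exists2 d : nat, has_dim P d &
    forall v, vertex P v ->
      ([set F : set (vec R E) | facet P F /\ F v] #= `I_d)%card.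

(* Main.v *)
Require Import Defs.
From mathcomp Require Import fintype finset ring lra.

(* Write [g = h o f] with [h t = 2 f(E) t - t^2], which is strictly concave and
   increasing on [[0, f(E)]].  The base polytope of [g] is the convex hull of the
   greedy points [v_r], one for each linear order [r] of [E].  Call [d] a jump
   of [r] if it is not in the closure of its predecessors; the complement of
   that closure is the largest member of [U(f)] whose first element is [d].
   Together with singletons at the non-jumps these sets form a rooted tree, and
   strict concavity shows that the tangent cone of the base polytope at [v_r] is
   freely generated by the vectors [e_x - e_parent(x)], [x] running over the
   non-loops other than the root.  This gives simplicity, and identifies the
   normal cone at [v_r] with the set of [w] that are maximized on every
   [S] in [U(f)] at the first element of [S], which is visibly the normal cone of
   the nestohedron at the corresponding point. *)

Set Implicit Arguments.
Unset Strict Implicit.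
Unset Printing Implicit Defensive.

Local Open Scope set_scope.

(** * Linear functionals *)

Section Dot.
Variables (R : realType) (E : finType).
Implicit Types (w x z : vec R E) (A : {set E}).

Lemma dotDr w x z : dot w (x + z) = dot w x + dot w z.
Proof.
by rewrite /dot -big_split; apply: eq_bigr => e _; rewrite ffunE mulrDr.
Qed.

Lemma dotZr w (t : R) x : dot w (t *: x) = t * dot w x.
Proof.
rewrite /dot big_distrr; apply: eq_bigr => e _; rewrite ffunE /=.
by rewrite mulrCA.
Qed.

Lemma dotBr w x z : dot w (x - z) = dot w x - dot w z.
Proof. by rewrite -scaleN1r dotDr dotZr mulN1r. Qed.

Lemma dot0r w : dot w 0 = 0.
Proof. by rewrite -(scale0r 0) dotZr mul0r. Qed.

Lemma dot_sumr (I : Type) (s : seq I) (Q : pred I) w (F : I -> vec R E) :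
  dot w (\sum_(i <- s | Q i) F i) = \sum_(i <- s | Q i) dot w (F i).
Proof. exact: (big_morph (dot w) (dotDr w) (dot0r w)). Qed.

Lemma dotNl w x : dot (- w) x = - dot w x.
Proof.
by rewrite /dot -sumrN; apply: eq_bigr => e _; rewrite ffunE mulNr.
Qed.

Lemma dot_std_basis w s : dot w (@std_basis R E s) = w s.
Proof.
rewrite /dot (bigD1 s) //= ffunE eqxx mulr1 big1 ?addr0 // => e /negPf es.
by rewrite ffunE es mulr0.
Qed.

Lemma vec_std_basis x : x = \sum_e (x e : R) *: std_basis R e.
Proof.
apply/ffunP => e; rewrite sum_ffunE (bigD1 e) //= big1 ?addr0.
  by rewrite !ffunE eqxx /=; rewrite [_ *: _]mulr1.
by move=> i /negPf ie; rewrite !ffunE eq_sym ie [_ *: _]mulr0.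
Qed.

Definition indicator A : vec R E := [ffun e => (e \in A)%:R].

(** Written as a pairing with an indicator, so that linearity in [x] comes from the lemmas on
    [dot]. *)
Definition mass x A : R := dot (indicator A) x.

Lemma massE x A : mass x A = \sum_(e in A) (x e : R).
Proof.
rewrite /mass /dot [RHS]big_mkcond; apply: eq_bigr => e _.
by rewrite ffunE; case: (e \in A); rewrite ?mul1r ?mul0r.
Qed.

Lemma massT x : mass x [set: E] = \sum_e (x e : R).
Proof. by rewrite massE; apply: eq_bigl => e; rewrite inE. Qed.

Lemma mass0 x : mass x finset.set0 = 0.
Proof. by rewrite massE big_set0. Qed.

Lemma massU1 x A e : e \notin A -> mass x (A :|: [set e]) = mass x A + x e.
Proof. by move=> eA; rewrite setUC !massE big_setU1 //= addrC. Qed.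

Lemma mass1 x e : mass x [set e] = x e.
Proof. by rewrite massE big_set1. Qed.

Lemma massUI x A B : mass x (A :|: B) + mass x (A :&: B) = mass x A + mass x B.
Proof.
rewrite /mass /dot -!big_split; apply: eq_bigr => e _ /=; rewrite !ffunE !inE.
by case: (e \in A); case: (e \in B); rewrite ?mul1r ?mul0r ?addr0 ?add0r.
Qed.

Lemma massC x A : mass x (~: A) = mass x [set: E] - mass x A.
Proof.
have := massUI x A (~: A); rewrite setUCr setICr mass0 addr0 => ->.
by rewrite addrC addKr.
Qed.

Lemma mass_std_basis e A : mass (std_basis R e) A = (e \in A)%:R.
Proof. by rewrite /mass dot_std_basis ffunE. Qed.

End Dot.

(** * Closure and flats *)

Section Closure.
Variables (R : realType) (E : finType) (f : {set E} -> R).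
Hypothesis hf : polymatroid f.
Implicit Types (A B F S : {set E}).

Definition closure A : {set E} := [set e | f (A :|: [set e]) == f A].

Lemma polymatroid_le A B : A \subset B -> f A <= f B.
Proof. by case: hf => _ _ h _ /setUidPr <-. Qed.

Lemma polymatroid_submod A B : f (A :|: B) + f (A :&: B) <= f A + f B.
Proof. by case: hf => _ _ _ h; have := h A B; lra. Qed.

Lemma sub_closure A : A \subset closure A.
Proof. by apply/subsetP => e eA; rewrite inE (setUidPl _) ?sub1set. Qed.

Lemma notin_closure A e : (e \notin closure A) = (f A < f (A :|: [set e])).
Proof.
by rewrite inE lt_def (polymatroid_le (subsetUl _ _)) andbT.
Qed.

(** Diminishing returns: by submodularity the gain of [e] over [B] is at most its gain over [A],
    which is zero. *)
Lemma closureS A B : A \subset B -> closure A \subset closure B.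
Proof.
move=> AB; apply/subsetP => e; rewrite !inE => /eqP eA.
rewrite eq_le (polymatroid_le (subsetUl _ _)) andbT.
have := polymatroid_submod B (A :|: [set e]).
rewrite setUA (setUidPl AB).
have := @polymatroid_le A (B :&: (A :|: [set e])).
rewrite subsetI AB subsetUl => /(_ isT); lra.
Qed.

Lemma rank_closure A : f (closure A) = f A.
Proof.
suff sub n B : #|B| = n -> B \subset closure A -> f (A :|: B) = f A.
  by rewrite -[in LHS](setUidPr (sub_closure A)) (sub _ _ erefl).
elim: n B => [|n IHn] B; first by move/cards0_eq->; rewrite setU0.
move=> cB BA; have /card_gt0P[e eB] : (0 < #|B|)%N by rewrite cB.
have cB' : #|B :\ e| = n by apply/eqP; rewrite -eqSS -cB [in _ == _](cardsD1 e B) eB.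
have BA' : B :\ e \subset closure A := subset_trans (subD1set _ _) BA.
rewrite -(IHn _ cB' BA').
have := subsetP (closureS (subsetUl A (B :\ e))) e (subsetP BA e eB).
by rewrite inE -setUA [_ :|: [set e]]setUC setD1K // => /eqP.
Qed.

Lemma flat_closure A : flat f (closure A).
Proof.
apply/forall_inP => e; rewrite notin_closure => lt_e.
rewrite rank_closure; apply: (lt_le_trans lt_e); apply: polymatroid_le.
exact/setSU/sub_closure.
Qed.

Lemma closure_flat F : flat f F -> closure F = F.
Proof.
move=> /forall_inP hF; apply/eqP; rewrite eqEsubset sub_closure andbT.
by apply/subsetP => e; apply: contraTT => /hF; rewrite notin_closure.
Qed.

Lemma flatI F1 F2 : flat f F1 -> flat f F2 -> flat f (F1 :&: F2).
Proof.
move=> h1 h2; suff <- : closure (F1 :&: F2) = F1 :&: F2 by apply: flat_closure.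
apply/eqP; rewrite eqEsubset sub_closure andbT subsetI.
rewrite -{2}(closure_flat h1) -{3}(closure_flat h2).
by rewrite !closureS ?subsetIl ?subsetIr.
Qed.

Lemma mem_flat_complements S : (S \in flat_complements f) = flat f (~: S).
Proof.
apply/imsetP/idP => [[F]|h]; first by rewrite inE => h ->; rewrite setCK.
by exists (~: S); rewrite ?inE ?setCK.
Qed.

Lemma building_set_flat_complements : building_set (flat_complements f).
Proof.
split=> [|S T].
  apply/set0Pn; exists finset.set0; rewrite mem_flat_complements finset.setC0.
  by apply/forall_inP => e; rewrite inE.
rewrite !mem_flat_complements => hS hT _.
by rewrite finset.setCU flatI.
Qed.

(** The map [h t = 2mt - t^2], with [m = f(E)], is increasing and concave on [[0, m]], which
    contains all values of [f]. *)
Lemma polymatroid_flag : polymatroid (flag_polymatroid f).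
Proof.
have [f0 fe _ _] := hf; rewrite /flag_polymatroid.
have le1 A : f A <= f [set: E] by apply/polymatroid_le/subsetT.
split=> [A||A B|A B].
- by have := f0 A; have := le1 A; nra.
- by rewrite fe; ring.
- have := polymatroid_le (subsetUl A B); have := le1 (A :|: B); nra.
have := polymatroid_le (subsetUl A B); have := le1 (A :|: B).
have := polymatroid_le (subsetUr A B); have := polymatroid_submod A B.
have := polymatroid_le (subsetIl A B); have := polymatroid_le (subsetIr A B).
set a := f A; set b := f B; set u := f (A :|: B); set i := f (A :&: B).
set m := f _ => hib hia hs hbu hum hau.
(* Since [h t - h s = (t - s)(2m - s - t)], the two increments of [h] are compared factor by
   factor. *)
have : (u - a) * (2 * m - u - a) <= (b - i) * (2 * m - b - i).
  apply: ler_pM; lra.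
nra.
Qed.

(* Strict concavity of [t |-> 2 f(E) t - t ^ 2]: a modular pair for the flag
   polymatroid cannot strictly raise the rank in both directions. *)
Lemma flag_strict_submod A B d :
  A \subset B -> f A < f B -> f A < f (A :|: [set d]) ->
  flag_polymatroid f (B :|: [set d]) + flag_polymatroid f A <
  flag_polymatroid f B + flag_polymatroid f (A :|: [set d]).
Proof.
move=> AB ltAB ltAd; rewrite /flag_polymatroid.
have := polymatroid_le (subsetT (B :|: [set d])).
have := polymatroid_le (setSU [set d] AB).
have := polymatroid_le (subsetUl B [set d]).
have := polymatroid_submod B (A :|: [set d]).
rewrite setUA (setUidPl AB).
have := @polymatroid_le A (B :&: (A :|: [set d])).
rewrite subsetI AB subsetUl => /(_ isT).
move: ltAB ltAd.
set a := f A; set b := f B; set u := f (B :|: _); set i := f (B :&: _).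
set c := f (A :|: _); set m := f [set: E] => ltab ltac leai hs hbu hcu hum.
(* Increments of [h] factored again: submodularity compares the first factors, and [a < b] with
   [c <= u] makes the comparison of the second ones strict. *)
have h1 : (u - b) * (2 * m - u - b) <= (c - a) * (2 * m - u - b).
  apply: ler_wpM2r; lra.
have h2 : (c - a) * (2 * m - u - b) < (c - a) * (2 * m - a - c).
  rewrite ltr_pM2l; lra.
nra.
Qed.

End Closure.

(** * Base polytopes and greedy vertices *)

(** Linear orders are encoded as injective rank functions. Sort by decreasing [w], break ties by
    [key], which puts [s] first in its level, and let the rank of [y] be the number of its
    predecessors. *)
Lemma refining_rank (R : realType) (E : finType) (w : E -> R) (s : E) :
  exists r : {ffun E -> 'I_#|E|},
    [/\ injective r, forall x y, w y < w x -> (r x < r y)%N &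
        forall x, w x = w s -> (r s <= r x)%N].
Proof.
pose key x : nat := if x == s then 0 else (enum_rank x).+1.
have key_inj : injective key.
  move=> x y; rewrite /key; case: eqP => [->|_]; case: eqP => [->|_] //.
  by move=> [] /val_inj /enum_rank_inj.
pose before x y := (w y < w x) || ((w x == w y) && (key x < key y)%N).
have irr x : before x x = false by rewrite /before ltxx eqxx ltnn.
have tr y x z : before x y -> before y z -> before x z.
  rewrite /before => /orP[h1|/andP[/eqP h1 k1]] /orP[h2|/andP[/eqP h2 k2]].
  - by rewrite (lt_trans h2 h1).
  - by rewrite -h2 h1.
  - by rewrite h1 h2.
  - by rewrite h1 h2 eqxx (ltn_trans k1 k2) orbT.
have tot x y : x != y -> before x y || before y x.
  move=> xy; rewrite /before; case: (ltgtP (w x) (w y)) => //= _.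
  by case: (ltngtP (key x) (key y)) => // /key_inj /eqP; rewrite (negPf xy).
pose c y := #|[set x | before x y]|.
have c_lt y : (c y < #|E|)%N.
  rewrite -cardsT; apply: proper_card; apply/properP; split; first exact: subsetT.
  by exists y; rewrite inE ?irr.
have c_mono x y : before x y -> (c x < c y)%N.
  move=> xy; apply: proper_card; apply/properP; split.
    by apply/subsetP => z; rewrite !inE => zx; apply: tr xy.
  by exists x; rewrite inE ?irr.
pose r : {ffun E -> 'I_#|E|} := [ffun y => Ordinal (c_lt y)].
have rE y : r y = c y :> nat by rewrite ffunE.
exists r; split=> [x y rxy|x y wxy|x wx].
- apply/eqP; apply: contraT => /tot /orP[] /c_mono; rewrite -!rE rxy ltnn //.
- by rewrite !rE c_mono // /before wxy.
- have [->|xs] := eqVneq x s; first by [].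
  by rewrite !rE ltnW // c_mono // /before wx eqxx /key eqxx (negPf xs) orbT.
Qed.

Section Base.
Variables (R : realType) (E : finType) (g : {set E} -> R).
Hypothesis hg : polymatroid g.
Implicit Types (A B T : {set E}) (x z : vec R E) (r : {ffun E -> 'I_#|E|}).

(** Nonnegativity comes from monotonicity: [x e = g(E) - x(E \ e) >= g(E) - g(E \ e) >= 0]. *)
Lemma base_polytopeP x :
  base_polytope g x <->
  (forall A, mass x A <= g A) /\ mass x [set: E] = g [set: E].
Proof.
split=> [[[_ h] hT]|[h hT]].
  by split=> [A|]; rewrite ?massT // massE.
split; last by rewrite -massT.
split=> [e|A]; last by rewrite -massE.
have := massC x [set e]; rewrite hT.
have := h (~: [set e]); have := polymatroid_le hg (subsetT (~: [set e])).
by rewrite mass1; lra.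
Qed.

(** * Tight sets and exchange directions *)

Definition tight x A := mass x A == g A.

(** Uncrossing: mass is modular and [g] submodular, so the slacks of union and intersection are
    nonnegative with sum at most zero. *)
Lemma tightUI x A B : base_polytope g x -> tight x A -> tight x B ->
  tight x (A :|: B) && tight x (A :&: B).
Proof.
move=> /base_polytopeP[h _] /eqP hA /eqP hB.
have := massUI x A B; have := polymatroid_submod hg A B.
have := h (A :|: B); have := h (A :&: B).
by move=> *; rewrite /tight !eq_le !h /=; apply/andP; split; lra.
Qed.

Lemma tight_bigcup x (I : finType) (P : pred I) (F : I -> {set E}) :
  base_polytope g x -> (forall i, P i -> tight x (F i)) ->
  tight x (\bigcup_(i | P i) F i).
Proof.
move=> bx h; apply: (big_ind (fun A => tight x A)) => // [|A B hA hB].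
  by rewrite /tight mass0; case: hg => _ -> _ _.
by have /andP[] := tightUI bx hA hB.
Qed.

Lemma tight_bigcap x (I : finType) (P : pred I) (F : I -> {set E}) :
  base_polytope g x -> (forall i, P i -> tight x (F i)) ->
  tight x (\bigcap_(i | P i) F i).
Proof.
move=> bx h; apply: (big_ind (fun A => tight x A)) => // [|A B hA hB].
  by rewrite /tight; case/base_polytopeP: bx => _ ->.
by have /andP[] := tightUI bx hA hB.
Qed.

Lemma mass_tilt x (t : R) e e' A :
  mass (x + t *: (std_basis R e - std_basis R e')) A =
  mass x A + t * ((e \in A)%:R - (e' \in A)%:R).
Proof. by rewrite /mass dotDr dotZr dotBr -!/(mass _ _) !mass_std_basis. Qed.

(** Mass is moved from [e'] to [e] as far as possible: [t] is the least slack among the sets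
    containing [e] but not [e'], and a set attaining it becomes tight. *)
Lemma tilt x e e' : base_polytope g x -> e != e' ->
  (forall T, tight x T -> e \in T -> e' \in T) ->
  exists2 t : R, 0 < t &
    let x' := x + t *: (std_basis R e - std_basis R e') in
    base_polytope g x' /\ exists A, [/\ e \in A, e' \notin A & tight x' A].
Proof.
move=> /base_polytopeP[hx hT] ee' sep.
pose Q A := (e \in A) && (e' \notin A).
have Q1 : Q [set e] by rewrite /Q !inE eqxx eq_sym.
case: (arg_minP (fun A => g A - mass x A) Q1) => A /andP[eA e'A] Amin.
exists (g A - mass x A) => /=.
  rewrite subr_gt0 lt_neqAle hx andbT; apply: contra e'A => tA.
  exact: sep tA eA.
split; last first.
  exists A; split=> //; rewrite /tight mass_tilt eA (negPf e'A).
  by rewrite subr0 mulr1 addrC subrK.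
apply/base_polytopeP; split=> [B|]; rewrite mass_tilt; last first.
  by rewrite !inE subrr mulr0 addr0.
have hA := hx A; have hB := hx B.
case eB : (e \in B); case e'B : (e' \in B); rewrite /= ?subrr ?subr0 ?sub0r.
- by rewrite mulr0 addr0.
- by have := Amin B; rewrite /Q eB e'B => /(_ isT); lra.
- by lra.
- by lra.
Qed.

(** * Greedy points of linear orders *)

Definition prefix r (k : nat) : {set E} := [set x | (r x < k)%N].

Lemma prefixS r e : injective r ->
  prefix r (r e).+1 = prefix r (r e) :|: [set e].
Proof.
move=> r_inj; apply/setP => x; rewrite !inE ltnS leq_eqVlt orbC.
by rewrite -(inj_eq r_inj).
Qed.

Lemma prefix_notin r e : e \notin prefix r (r e).
Proof. by rewrite inE ltnn. Qed.

Lemma prefixS_id r k : (forall e, r e != k :> nat) -> prefix r k.+1 = prefix r k.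
Proof.
by move=> h; apply/setP => x; rewrite !inE ltnS leq_eqVlt (negPf (h x)).
Qed.

Lemma prefix0 r : prefix r 0 = finset.set0.
Proof. by apply/setP => x; rewrite !inE. Qed.

Lemma prefixT r : prefix r #|E| = [set: E].
Proof. by apply/setP => x; rewrite !inE ltn_ord. Qed.

Lemma prefix_le r j k : (j <= k)%N -> prefix r j \subset prefix r k.
Proof. by move=> jk; apply/subsetP => x; rewrite !inE => h; apply: leq_trans jk. Qed.

(** Edmonds' greedy vertex: the marginal gains of [g] along the order [r]. *)
Definition greedy r : vec R E :=
  [ffun e => g (prefix r (r e).+1) - g (prefix r (r e))].

Lemma mass_greedy_prefix r k : injective r ->
  mass (greedy r) (prefix r k) = g (prefix r k).
Proof.
move=> r_inj; elim: k => [|k IHk].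
  by rewrite prefix0 mass0; case: hg.
have [/existsP[e /eqP re]|/existsPn h] := boolP [exists e, r e == k :> nat];
  last by rewrite prefixS_id.
rewrite -re prefixS // massU1 ?prefix_notin // re IHk ffunE re.
by rewrite -re prefixS // addrC subrK.
Qed.

Lemma mass_greedy_le r A : injective r -> mass (greedy r) A <= g A.
Proof.
move=> r_inj; suff h k : mass (greedy r) (A :&: prefix r k) <= g (A :&: prefix r k).
  by have := h #|E|; rewrite prefixT setIT.
elim: k => [|k IHk].
  by rewrite prefix0 setI0 mass0; case: hg.
have [/existsP[e /eqP re]|/existsPn h] := boolP [exists e, r e == k :> nat];
  last by rewrite prefixS_id.
rewrite -re prefixS // setIUr; have [eA|eA] := boolP (e \in A); last first.
  have /disjoint_setI0 -> : [disjoint A & [set e]].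
    by rewrite disjoint_sym disjoints1.
  by rewrite setU0 re.
have -> : A :&: [set e] = [set e] by apply/setIidPr; rewrite sub1set.
rewrite massU1 ?inE ?ltnn ?andbF // ffunE prefixS //.
(* The gain of [e] over the whole prefix, which is its greedy coordinate, is at most its gain over
   the part of the prefix in [A]. *)
have := polymatroid_submod hg (prefix r (r e)) (A :&: prefix r (r e) :|: [set e]).
have -> : prefix r (r e) :|: (A :&: prefix r (r e) :|: [set e])
          = prefix r (r e) :|: [set e].
  by rewrite setUA (setUidPl (subsetIr _ _)).
have -> : prefix r (r e) :&: (A :&: prefix r (r e) :|: [set e])
          = A :&: prefix r (r e).
  apply/setP => x; rewrite !inE; case: eqP => [->|_]; rewrite ?ltnn ?andbF //.
  by rewrite orbF andbC -andbA andbb.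
by move: IHk; rewrite -re; lra.
Qed.

Lemma base_greedy r : injective r -> base_polytope g (greedy r).
Proof.
move=> r_inj; apply/base_polytopeP; split=> [A|]; first exact: mass_greedy_le.
by rewrite -(prefixT r) mass_greedy_prefix.
Qed.

Lemma tight_greedy_prefix r k : injective r -> tight (greedy r) (prefix r k).
Proof. by move=> r_inj; rewrite /tight mass_greedy_prefix. Qed.

(* If the tight sets separate the points, then the smallest tight set [T e]
   around [e] minus [e] is still tight, and any linear extension of inclusion
   of the [T e] gives a chain of tight prefixes. *)
Lemma separated_greedy x (e0 : E) : base_polytope g x ->
  (forall e e', e != e' -> exists2 A, tight x A & (e \in A) != (e' \in A)) ->
  exists2 r : {ffun E -> 'I_#|E|}, injective r & x = greedy r.
Proof.
move=> bx sep.
pose T e := \bigcap_(A | tight x A && (e \in A)) A.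
have tT e : tight x (T e) by apply: tight_bigcap => // A /andP[].
have eT e : e \in T e by apply/bigcapP => A /andP[].
have Tmin e A : tight x A -> e \in A -> T e \subset A.
  by move=> tA eA; apply: bigcap_inf; rewrite tA eA.
have Tinj e (z : E) : z \in T e -> z != e -> (#|T z| < #|T e|)%N.
  move=> zT ze; apply: proper_card; rewrite properEneq (Tmin _ _ (tT e) zT) andbT.
  have [A tA] := sep _ _ ze; apply: contra => /eqP eqT.
  apply/eqP; apply/idP/idP => [zA|eA].
    by apply: (subsetP (Tmin _ _ tA zA)); rewrite eqT.
  by apply: (subsetP (Tmin _ _ tA eA)); rewrite -eqT.
have [r [r_inj r_mono _]] := refining_rank (fun e => - #|T e|%:R : R) e0.
exists r => //.
have tpre k : tight x (prefix r k).
  suff -> : prefix r k = \bigcup_(y in prefix r k) T y by apply: tight_bigcup.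
  apply/eqP; rewrite eqEsubset; apply/andP; split; apply/subsetP => y.
    by move=> yk; apply/bigcupP; exists y.
  case/bigcupP => z; rewrite !inE => zk yz; have [->//|yz'] := eqVneq y z.
  apply: ltn_trans zk; apply: r_mono; rewrite ltrN2 ltr_nat.
  exact: Tinj.
apply/ffunP => e; rewrite ffunE -(eqP (tpre _)) -(eqP (tpre _)) prefixS //.
by rewrite massU1 ?prefix_notin // [RHS]addrC addKr.
Qed.

(** Weights live on all rank functions, so that the sum is over a finite type; only injective ones
    may carry weight. *)
Definition greedy_hull x : Prop := exists c : {ffun E -> 'I_#|E|} -> R,
  [/\ forall r, 0 <= c r,
      forall r : {ffun E -> 'I_#|E|}, c r != 0 -> injective r,
      \sum_r c r = 1 &
      x = \sum_r c r *: greedy r].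

Lemma greedy_hull_conv (a b : R) x z : 0 <= a -> 0 <= b -> a + b = 1 ->
  greedy_hull x -> greedy_hull z -> greedy_hull (a *: x + b *: z).
Proof.
move=> a0 b0 ab [c [c0 ci c1 ->]] [d [d0 di d1 ->]].
exists (fun r => a * c r + b * d r); split=> [r|r||].
- by rewrite addr_ge0 ?mulr_ge0.
- have [->|/ci//] := eqVneq (c r) 0.
  have [->|/di//] := eqVneq (d r) 0.
  by rewrite !mulr0 addr0 eqxx.
- by rewrite big_split -!mulr_sumr c1 d1 !mulr1.
rewrite !scaler_sumr -big_split; apply: eq_bigr => r _ /=.
by rewrite !scalerA -scalerDl.
Qed.

(** Induction on the number of non-tight sets. If the tight sets fail to separate [e] from [e'],
    then [x] can be tilted both ways, keeping every tight set and gaining one, and it lies between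
    the two results. *)
Lemma base_polytope_greedy_hull x (e0 : E) : base_polytope g x -> greedy_hull x.
Proof.
have [n] := ubnP #|[set A | ~~ tight x A]|; elim: n x => // n IHn x xn bx.
have [sep|/existsNP[e /existsNP[e' /not_implyP[ee' nsep]]]] :=
  pselect (forall e e', e != e' -> exists2 A, tight x A & (e \in A) != (e' \in A)).
  have [r r_inj ->] := separated_greedy e0 bx sep.
  exists (fun r' => (r' == r)%:R); split=> [r'|r'||].
  - exact: ler0n.
  - by have [->//|_] := eqVneq r' r; rewrite eqxx.
  - by rewrite (bigD1 r) //= eqxx big1 ?addr0 // => r' /negPf ->.
  - by rewrite (bigD1 r) //= eqxx scale1r big1 ?addr0 // => r' /negPf ->; rewrite scale0r.
have same T : tight x T -> (e \in T) = (e' \in T).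
  by move=> tT; apply/eqP; apply: contraT => h; case: nsep; exists T.
have step a b : a != b -> (forall T, tight x T -> (a \in T) = (b \in T)) ->
    exists2 t : R, 0 < t & greedy_hull (x + t *: (std_basis R a - std_basis R b)).
  move=> ab sab; have [|t t0 /= [bx' [A [aA bA tA]]]] := @tilt x a b bx ab.
    by move=> T /sab ->.
  exists t => //; apply: IHn bx'; rewrite -ltnS; apply: leq_trans xn; rewrite ltnS.
  apply: proper_card; apply/properP; split.
    apply/subsetP => T; rewrite !inE; apply: contra => tT.
    by rewrite /tight mass_tilt (sab _ tT) subrr mulr0 addr0.
  exists A; rewrite !inE ?tA //; apply: contra bA => tA'.
  by rewrite -(sab _ tA').
have [t t0 ht] := step _ _ ee' same.
have [|u u0 hu] := step e' e _ (fun T tT => esym (same T tT)).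
  by rewrite eq_sym.
have tu : t + u != 0 by rewrite gt_eqF // addr_gt0.
(* These weights cancel the opposite displacements [t] and [u]. *)
have -> : x = u / (t + u) *: (x + t *: (std_basis R e - std_basis R e'))
            + t / (t + u) *: (x + u *: (std_basis R e' - std_basis R e)).
  apply/ffunP => y; rewrite !ffunE /=.
  by rewrite /GRing.scale /=; field.
apply: greedy_hull_conv => //.
- by rewrite divr_ge0 // ltW // addr_gt0.
- by rewrite divr_ge0 // ltW // addr_gt0.
- by rewrite -mulrDl addrC divff.
Qed.

End Base.

(** * The tangent cone at a greedy vertex of the flag polymatroid *)

Section Tree.
Variables (R : realType) (E : finType) (f : {set E} -> R).
Hypotheses (hf : polymatroid f) (hE : 0 < f [set: E]).
Variable r : {ffun E -> 'I_#|E|}.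
Hypothesis r_inj : injective r.
Implicit Types (A B S T : {set E}) (x w : vec R E) (d e y : E).

Let g := flag_polymatroid f.
Let hg : polymatroid g := polymatroid_flag hf.
Let v := greedy g r.
Let hv : base_polytope g v := base_greedy hg r_inj.

Definition nonloops : {set E} := ~: closure f finset.set0.

Definition jump d := d \notin closure f (prefix r (r d)).

(* The largest member of the building set whose first element is [d]; when
   there is none, the singleton of [d], which only translates the nestohedron. *)
Definition node d : {set E} :=
  if jump d then ~: closure f (prefix r (r d)) else [set d].

(** The common normal cone: it turns out to be the cone at the greedy point of [r] and at the
    corresponding point of the nestohedron. *)
Definition nested_cone w : Prop := forall S d,
  S \in flat_complements f -> d \in S -> (forall s, s \in S -> (r d <= r s)%N) ->
  forall s, s \in S -> w s <= w d.

Lemma node_refl d : d \in node d.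
Proof. by rewrite /node; case: ifP; rewrite /jump !inE. Qed.

Lemma node_rank d e : e \in node d -> (r d <= r e)%N.
Proof.
rewrite /node; case: ifP => _; last by rewrite inE => /eqP ->.
rewrite inE; apply: contraNT; rewrite -ltnNge => lt_ed.
by apply: (subsetP (sub_closure f _)); rewrite inE.
Qed.

Lemma node_jump d e : e \in node d -> e != d -> jump d.
Proof. by rewrite /node; case: ifP => // _; rewrite inE => ->. Qed.

Lemma node_chain d e : jump d -> jump e -> (r d <= r e)%N -> node e \subset node d.
Proof.
rewrite /node => -> -> de; rewrite setCS.
exact/(closureS hf)/prefix_le.
Qed.

Lemma node_flat_complement d : jump d -> node d \in flat_complements f.
Proof. by rewrite mem_flat_complements /node => ->; rewrite setCK flat_closure. Qed.

(** The elements before [d] lie in the flat [~: S], hence so does their closure; taking complements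
    gives the inclusion. *)
Lemma sub_node S d : S \in flat_complements f -> d \in S ->
  (forall s, s \in S -> (r d <= r s)%N) -> jump d /\ S \subset node d.
Proof.
rewrite mem_flat_complements => hS dS dmin.
have sub : closure f (prefix r (r d)) \subset ~: S.
  rewrite -(closure_flat hf hS); apply: closureS => //.
  apply/subsetP => x; rewrite !inE; apply: contraTN => /dmin.
  by rewrite -leqNgt.
have jd : jump d by apply: contraL dS => /(subsetP sub); rewrite inE.
by split=> //; rewrite /node jd -setCS setCK.
Qed.

Lemma jump_nonloop d : jump d -> d \in nonloops.
Proof.
by rewrite inE; apply: contra; apply: (subsetP (closureS hf _)); apply: sub0set.
Qed.

(** At a jump, closing the tight prefix leaves [g] unchanged, so [v] has the largest possible mass
    on the closure and the least on its complement. At a non-jump, the greedy coordinate of [d] is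
    zero. *)
Lemma mass_node_ge x d : base_polytope g x -> mass v (node d) <= mass x (node d).
Proof.
move=> bx; have [hx hT] := (base_polytopeP hg x).1 bx.
have [hvl hvT] := (base_polytopeP hg v).1 hv.
have gcl A : g (closure f A) = g A by rewrite /g /flag_polymatroid rank_closure.
rewrite /node; case: ifPn => [_|].
  rewrite !massC hT hvT lerD2l lerN2; apply: (le_trans (hx _)).
  rewrite gcl -(mass_greedy_prefix hg _ r_inj) -/v !massE.
  rewrite [leRHS](big_setID (prefix r (r d))) /= (setIidPr (sub_closure _ _)).
  by rewrite lerDl sumr_ge0 // => e _; case: hv => -[].
rewrite /jump notin_closure // -leNgt => h.
rewrite !mass1; case: bx => -[x0 _] _; apply: le_trans (x0 d).
rewrite ffunE subr_le0 prefixS //.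
have e1 : f (prefix r (r d) :|: [set d]) = f (prefix r (r d)).
  by apply/eqP; rewrite eq_le h polymatroid_le ?subsetUl.
by rewrite /g /flag_polymatroid e1.
Qed.

(* Uncrossing a tight [T] that contains [e] but not [d] with the tight prefixes
   before and up to [d] would produce a modular pair forbidden by strictness. *)
Lemma tight_node d e T : jump d -> e \in node d -> tight g v T -> e \in T -> d \in T.
Proof.
move=> jd; rewrite {1}/node jd inE => ed tT eT.
set A := prefix r (r d) in ed; apply: contraT => dT.
have tA : tight g v A := tight_greedy_prefix hg _ r_inj.
have tA' : tight g v (A :|: [set d]) by rewrite -prefixS //; apply: tight_greedy_prefix.
have /andP[tB _] := tightUI hg hv tT tA.
have /andP[tB' _] := tightUI hg hv tB tA'.
have AB : A \subset T :|: A := subsetUr _ _.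
have := @flag_strict_submod _ _ _ hf A (T :|: A) d AB.
rewrite -(notin_closure hf A d) -/g => h.
have ltAB : f A < f (T :|: A).
  move: ed; rewrite notin_closure // => lt_e; apply: (lt_le_trans lt_e).
  by apply: polymatroid_le => //; rewrite setUC setSU ?sub1set.
have {h} := h ltAB jd.
rewrite setUA (setUidPl AB) in tB'.
rewrite -(eqP tA) -(eqP tA') -(eqP tB) -(eqP tB').
rewrite !massU1 ?prefix_notin //; last by rewrite inE negb_or dT prefix_notin.
by rewrite addrAC addrA ltxx.
Qed.

Lemma node_feasible d e : e \in node d -> e != d ->
  exists2 t : R, 0 < t & base_polytope g (v + t *: (std_basis R e - std_basis R d)).
Proof.
move=> ed e_d; have jd := node_jump ed e_d.
have [T tT eT|t t0 /= [bt _]] := @tilt _ _ _ hg v e d hv e_d; last by exists t.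
exact: tight_node tT eT.
Qed.

(** Moving mass from [d] to [s] is feasible at [v], so it cannot increase an optimal [w]. *)
Lemma optimal_nested_cone w :
  (forall z, base_polytope g z -> dot w z <= dot w v) -> nested_cone w.
Proof.
move=> wopt S d hS dS dmin s sS; have [jd Sd] := sub_node hS dS dmin.
have [->//|sd] := eqVneq s d.
have [t t0 /wopt] := node_feasible (subsetP Sd s sS) sd.
rewrite dotDr gerDl dotZr pmulr_rle0 // dotBr !dot_std_basis.
by rewrite subr_le0.
Qed.

(** If every element were a loop, [f(E)] would be the rank of the closure of the empty set, which is
    zero. *)
Lemma root_exists :
  exists2 q, q \in nonloops & forall e, e \in nonloops -> (r q <= r e)%N.
Proof.
have [e0 e0P] : exists e, e \in nonloops.
  apply/set0Pn; apply: contraTneq hE => n0.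
  have cT : closure f finset.set0 = [set: E].
    by rewrite -(setCK (closure _ _)) -/nonloops n0 setC0.
  by rewrite -cT rank_closure //; case: hf => _ -> _ _; rewrite ltxx.
by case: (arg_minnP (fun e => r e : nat) e0P) => q qP qmin; exists q.
Qed.

(** Only loops precede the first non-loop, so the closure of its prefix is the least flat. *)
Lemma root_node q : q \in nonloops ->
  (forall e, e \in nonloops -> (r q <= r e)%N) -> jump q /\ node q = nonloops.
Proof.
move=> qn qmin.
have eq : closure f (prefix r (r q)) = closure f finset.set0.
  apply/eqP; rewrite eqEsubset (closureS hf (sub0set _)) andbT.
  rewrite -(closure_flat hf (flat_closure hf finset.set0)).
  apply: closureS => //; apply/subsetP => e; rewrite inE; apply: contraTT.
  by move=> en; rewrite -leqNgt qmin // inE.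
have jq : jump q by rewrite /jump eq; move: qn; rewrite inE.
by rewrite /node jq eq.
Qed.

(** Nodes of jumps form a decreasing chain, so the last jump other than [e] whose node contains [e]
    serves as parent. The last clause says that [e] and its parent are separated by no node except
    possibly that of [e]; this makes the node indicators dual to the tree edges. *)
Lemma parent_exists : exists (q : E) (p : E -> E), q \in nonloops /\
  forall e, e \in nonloops ->
    (q \in node e -> e = q) /\
    (e != q -> [/\ e \in node (p e), p e \in nonloops, (r (p e) < r e)%N &
                   forall d, d != e -> (e \in node d) = (p e \in node d)]).
Proof.
have [q qn qmin] := root_exists; have [jq nq] := root_node qn qmin.
exists q.
suff /choice[p pP] : forall e, exists p, e \in nonloops -> e != q ->
    [/\ e \in node p, p \in nonloops, (r p < r e)%N &
        forall d, d != e -> (e \in node d) = (p \in node d)].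
  exists p; split=> // e en; split=> [|eq]; last exact: pP.
  move=> /node_rank qe; apply/r_inj/val_inj/eqP.
  by rewrite eqn_leq qe qmin.
(* Loops and the root receive arbitrary values. *)
move=> e; have [en|en] := boolP (e \in nonloops); last by exists e.
have [->|eq] := eqVneq e q; first by exists q.
pose Q d := [&& jump d, d != e & e \in node d].
have Qq : Q q by rewrite /Q jq eq_sym eq nq.
case: (arg_maxnP (fun d => r d : nat) Qq) => p /and3P[jp pe ep] pmax.
exists p => _ _; split=> //; first exact: jump_nonloop.
  rewrite ltn_neqAle node_rank // andbT.
  by apply: contra pe => /eqP /val_inj /r_inj ->.
move=> d de; apply/idP/idP => [ed|pd].
  have jd : jump d by apply: node_jump ed _; rewrite eq_sym.
  apply: (subsetP (node_chain jd jp _)) (node_refl p).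
  by apply: pmax; rewrite /Q jd de ed.
have [->//|pd'] := eqVneq d p.
have jd : jump d by apply: node_jump pd _; rewrite eq_sym.
by apply: (subsetP (node_chain jd jp (node_rank pd))).
Qed.

Lemma base_loop x e : base_polytope g x -> e \notin nonloops -> x e = 0.
Proof.
move=> bx; have [hx _] := (base_polytopeP hg x).1 bx.
rewrite inE negbK inE set0U => /eqP fe.
have f0 : f finset.set0 = 0 by case: hf.
have := hx [set e]; rewrite mass1 /g /flag_polymatroid fe f0.
by rewrite mulr0 expr0n subr0 => h; apply/eqP; rewrite eq_le h; case: bx => -[->].
Qed.

(* [u i] is the indicator of the node at the [i]-th non-root [e], and
   [b i = e_e - e_parent(e)]. *)
Lemma greedy_tangent_basis :
  exists (b u : 'I_(#|nonloops|.-1) -> vec R E),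
    [/\ forall i j, dot (u i) (b j) = (i == j)%:R,
        forall x, base_polytope g x -> x - v = \sum_i dot (u i) (x - v) *: b i,
        forall x i, base_polytope g x -> 0 <= dot (u i) (x - v),
        forall i, exists2 t : R, 0 < t & base_polytope g (v + t *: b i) &
        forall w i, nested_cone w -> dot w (b i) <= 0].
Proof.
have [q [p [qn tree]]] := parent_exists.
pose J := nonloops :\ q.
have cJ : #|nonloops|.-1 = #|J| by rewrite [in LHS](cardsD1 q) qn.
rewrite cJ; pose b e := std_basis R e - std_basis R (p e).
have JP e : e \in J -> [/\ e \in nonloops, e != q & e \in node (p e)].
  by rewrite in_setD1 => /andP[eq en]; have [_ /(_ eq)[]] := tree e en.
have pe e : e \in J -> e != p e.
  case/JP => en eq _; have [_ /(_ eq)[_ _ lt_pe _]] := tree e en.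
  by apply: contraTneq lt_pe => <-; rewrite ltnn.
(* Only the node of [e] can tell [e] from its parent, and it omits the parent, which comes earlier
   in [r]. *)
have dual d e : d \in J -> e \in J -> mass (b e) (node d) = (d == e)%:R.
  move=> dJ eJ; rewrite /mass dotBr -!/(mass _ _) !mass_std_basis.
  have [en eq _] := JP e eJ; have [_ /(_ eq)[_ _ lt_pe same]] := tree e en.
  have [->|de] := eqVneq d e; last by rewrite same // subrr.
  rewrite node_refl; case: (boolP (p e \in _)) => [/node_rank|_]; last by rewrite subr0.
  by rewrite leqNgt lt_pe.
(* Climbing from [y] to the root, by induction on rank: the edges used are those of the [e] with [y]
   in [node e]. *)
have path y : y \in nonloops ->
    std_basis R y - std_basis R q = \sum_(e in J) (indicator R (node e) y : R) *: b e.
  have [n] := ubnP (r y : nat); elim: n y => // n IHn y; rewrite ltnS => yn yl.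
  have [qroot par] := tree y yl.
  have [->|yq] := eqVneq y q.
    rewrite subrr big1 // => e eJ; have [en eq _] := JP e eJ.
    rewrite ffunE; case: (boolP (q \in _)); last by rewrite scale0r.
    by have [h _] := tree e en; move=> /h /eqP; rewrite (negPf eq).
  have [_ pn lt_py same] := par yq.
  have yJ : y \in J by rewrite in_setD1 yq.
  rewrite (bigD1 y) //= ffunE node_refl scale1r.
  transitivity (b y + (std_basis R (p y) - std_basis R q)).
    by rewrite /b addrA subrK.
  congr (_ + _); rewrite (IHn (p y)) //; last exact: leq_trans yn.
  rewrite (bigD1 y) //= ffunE; case: (boolP (p y \in _)) => [/node_rank|_].
    by rewrite leqNgt lt_py.
  rewrite scale0r add0r; apply: eq_bigr => e /andP[_ ey].
  by rewrite !ffunE same.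
have expand x : base_polytope g x ->
    x - v = \sum_(e in J) mass (x - v) (node e) *: b e.
  move=> bx; set D := x - v.
  have D0 e : e \notin nonloops -> D e = 0.
    by move=> en; rewrite /D 2!ffunE (base_loop bx en) (base_loop hv en) subr0.
  have sD : \sum_e (D e : R) = 0.
    rewrite -massT /mass dotBr -!/(mass _ _).
    case: ((base_polytopeP hg x).1 bx) => _ ->.
    by case: ((base_polytopeP hg v).1 hv) => _ ->; rewrite subrr.
  (* Because [D] has total mass zero, each basis vector may be replaced by its difference with that
     of the root. *)
  transitivity (\sum_y (D y : R) *: (std_basis R y - std_basis R q)).
    under eq_bigr do rewrite scalerBr.
    by rewrite sumrB -scaler_suml sD scale0r subr0 -vec_std_basis.
  transitivity (\sum_y \sum_(e in J) ((D y : R) * (indicator R (node e) y : R)) *: b e).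
    apply: eq_bigr => y _; have [yn|yn] := boolP (y \in nonloops).
      by rewrite path // scaler_sumr; apply: eq_bigr => e _; rewrite scalerA.
    by rewrite D0 // scale0r big1 // => e _; rewrite mul0r scale0r.
  rewrite exchange_big; apply: eq_bigr => e _; rewrite -scaler_suml; congr (_ *: _).
  by apply: eq_bigr => y _; rewrite mulrC.
exists (fun i : 'I_#|J| => b (enum_val i)), (fun i => indicator R (node (enum_val i))).
split=> [i j|x bx|x i bx|i|w i wC].
- by rewrite -/(mass _ _) dual ?enum_valP // (inj_eq enum_val_inj).
- by rewrite [LHS]expand // big_enum_val.
- by rewrite dotBr subr_ge0; apply: mass_node_ge.
- by have [_ _ ein] := JP _ (enum_valP i); apply: node_feasible => //; apply/pe/enum_valP.
- have [_ _ ein] := JP _ (enum_valP i); have jd := node_jump ein (pe _ (enum_valP i)).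
  rewrite dotBr !dot_std_basis subr_le0.
  by apply: (wC (node (p (enum_val i)))) => //;
    [exact: node_flat_complement|exact: node_refl|exact: node_rank].
Qed.

(** Tangent coordinates are nonnegative and [w] is nonpositive on each generator. *)
Lemma nested_cone_optimal w : nested_cone w ->
  forall z, base_polytope g z -> dot w z <= dot w v.
Proof.
move=> wC z bz; have [b [u [_ expand ge0 _ le0]]] := greedy_tangent_basis.
rewrite -subr_le0 -dotBr expand // dot_sumr sumr_le0 // => i _.
by rewrite dotZr mulr_ge0_le0 ?ge0 ?le0.
Qed.

End Tree.

(** * Facets at a vertex with a simplicial tangent cone *)

(** The least direction space does not depend on the base point. *)
Lemma has_dim_uniq (R : realType) (E : finType) (P : set (vec R E)) d d' :
  has_dim P d -> has_dim P d' -> d = d'.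
Proof.
have le x0 x1 (U U' : {vspace vec R E}) : P x0 ->
    (forall W : {vspace vec R E}, (forall x, P x -> x - x0 \in W) -> (U <= W)%VS) ->
    (forall x, P x -> x - x1 \in U') -> (U <= U')%VS.
  move=> px0 Umin hU'; apply: Umin => x px.
  have -> : x - x0 = (x - x1) - (x0 - x1) by rewrite opprB addrA subrK.
  by rewrite rpredB ?hU'.
move=> [x0 [U [p0 hU Umin <-]]] [x1 [U' [p1 hU' Umin' <-]]].
congr (\dim _); apply/subv_anti.
by rewrite (le _ _ _ _ p0 Umin hU') (le _ _ _ _ p1 Umin' hU).
Qed.

Section Simplicial.
Variables (R : realType) (E : finType) (P : set (vec R E)) (v : vec R E).
Variables (d : nat) (b u : 'I_d -> vec R E).
Hypotheses (Pv : P v) (dual : forall i j, dot (u i) (b j) = (i == j)%:R)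
  (expand : forall x, P x -> x - v = \sum_i dot (u i) (x - v) *: b i)
  (coord_ge0 : forall x i, P x -> 0 <= dot (u i) (x - v))
  (feasible : forall i, exists2 t : R, 0 < t & P (v + t *: b i)).

Lemma has_dim_coord_face (F : set (vec R E)) (K : {set 'I_d}) : F v ->
  (forall x, F x -> P x /\ forall j, j \notin K -> dot (u j) (x - v) = 0) ->
  (forall j t, j \in K -> P (v + t *: b j) -> F (v + t *: b j)) ->
  has_dim F #|K|.
Proof.
move=> Fv FK KF; pose X := [tuple b (enum_val i) | i < #|K|].
have XE (i : 'I_#|K|) : X`_i = b (enum_val i) by rewrite -tnth_nth tnth_mktuple.
exists v, <<X>>%VS; split=> // [x /FK[Px x0]|W hW|].
- rewrite expand // (bigID [in K]) /= addrC big1 ?add0r => [|j /x0 ->]; last first.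
    by rewrite scale0r.
  rewrite big_enum_val rpred_sum // => i _; rewrite rpredZ // memv_span //.
  by rewrite -XE mem_nth // size_tuple.
- apply/span_subvP => z /tnthP[i ->]; rewrite tnth_mktuple.
  have [t t0 Pt] := feasible (enum_val i).
  have := hW _ (KF _ _ (enum_valP i) Pt).
  by rewrite addrC addKr rpredZeq gt_eqF.
- suff /eqP -> : free X by rewrite size_tuple.
  apply/freeP => k k0 i; have /(congr1 (dot (u (enum_val i)))) := k0.
  rewrite dot0r dot_sumr (bigD1 i) //= big1 ?addr0 => [|j ji].
    by rewrite XE dotZr dual eqxx mulr1.
  by rewrite XE dotZr dual (inj_eq enum_val_inj) eq_sym (negPf ji) mulr0.
Qed.

Lemma has_dim_simplicial : has_dim P d.
Proof.
rewrite -[d in has_dim _ d]card_ord -cardsT; apply: has_dim_coord_face => // x Px.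
by split=> // j; rewrite inE.
Qed.

Definition coord_facet (i : 'I_d) : set (vec R E) :=
  [set x | P x /\ dot (u i) (x - v) = 0]%classic.

Lemma coord_facet_vertex i : coord_facet i v.
Proof. by split=> //; rewrite subrr dot0r. Qed.

Lemma coord_facet_facet i : facet P (coord_facet i).
Proof.
split.
  split; first by exists v; apply: coord_facet_vertex.
  exists (- u i); apply/seteqP; split=> x.
    move=> [Px x0]; split=> // z Pz; have := coord_ge0 i Pz.
    by move: x0; rewrite !dotBr !dotNl; lra.
  move=> [Px /(_ v Pv)] h; split=> //; have := coord_ge0 i Px.
  by move: h; rewrite !dotBr !dotNl; lra.
(* The index [i] itself forces [d] to be positive. *)
have [d0 dE] : exists d0, d = d0.+1.
  by exists d.-1; rewrite prednK // (leq_ltn_trans _ (ltn_ord i)).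
exists d0; split; first by rewrite -dE; apply: has_dim_simplicial.
have <- : #|[set~ i]| = d0 by rewrite cardsC1 card_ord dE.
apply: has_dim_coord_face; first exact: coord_facet_vertex.
  by move=> x [Px x0]; split=> // j; rewrite !inE negbK => /eqP ->.
move=> j t; rewrite !inE => ji Pt; split=> //.
by rewrite addrC addKr dotZr dual eq_sym (negPf ji) mulr0.
Qed.

(** A face through [v] maximizing [w] is cut out by the vanishing of the coordinates on which [w] is
    negative. Its dimension is the number of remaining ones, so for a facet exactly one coordinate
    vanishes identically. *)
Lemma facet_coord_facet F : facet P F -> F v -> exists i, F = coord_facet i.
Proof.
move=> [[_ [w FE]] [d0 [dP dF]]] Fv.
have [_ vmax] : max_face P w v by rewrite -FE.
have wb i : dot w (b i) <= 0.
  have [t t0 /vmax] := feasible i.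
  by rewrite dotDr dotZr gerDl pmulr_rle0.
pose K := [set i | dot w (b i) == 0].
have FK x : F x <-> P x /\ forall j, j \notin K -> dot (u j) (x - v) = 0.
  have wx : P x -> dot w x - dot w v = \sum_i dot (u i) (x - v) * dot w (b i).
    move=> Px; rewrite -dotBr [in LHS]expand // dot_sumr.
    by apply: eq_bigr => i _; rewrite dotZr.
  rewrite FE; split=> [[Px xmax]|[Px x0]]; split=> //.
    move=> j jK; have /eqP : - \sum_i dot (u i) (x - v) * dot w (b i) = 0.
      by rewrite -wx //; have := xmax v Pv; have := vmax x Px; lra.
    rewrite -sumrN psumr_eq0 => [/allP/(_ j)|i _]; last first.
      by rewrite oppr_ge0 mulr_ge0_le0 ?coord_ge0.
    rewrite mem_index_enum => /(_ isT); rewrite oppr_eq0 mulf_eq0.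
    by move: jK; rewrite inE => /negPf ->; rewrite orbF => /eqP.
  move=> z /vmax /le_trans -> //; rewrite -subr_ge0 wx //.
  rewrite big1 // => i _; have [|/x0 ->] := boolP (i \in K); last by rewrite mul0r.
  by rewrite inE => /eqP ->; rewrite mulr0.
have cK : d0 = #|K|.
  apply: has_dim_uniq dF _; apply: has_dim_coord_face => // [x /FK//|j t jK Pt].
  apply/FK; split=> // i iK; rewrite addrC addKr dotZr dual.
  by case: eqP iK => [->|_ _]; rewrite ?jK ?mulr0.
have dE : d0.+1 = d := has_dim_uniq dP has_dim_simplicial.
have /cards1P[i Ki] : #|~: K| == 1%N.
  by rewrite -(eqn_add2l #|K|) cardsC card_ord -cK addn1 dE.
have nK j : (j \notin K) = (j == i) by rewrite -in_setC Ki inE.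
exists i; apply/seteqP; split=> x.
  by move=> /FK[Px x0]; split=> //; apply: x0; rewrite nK.
by move=> [Px x0]; apply/FK; split=> // j; rewrite nK => /eqP ->.
Qed.

(** The point [v + t *: b j] lies on every coordinate facet except the [j]-th. *)
Lemma coord_facet_inj : injective coord_facet.
Proof.
move=> i j eqF; have [t t0 Pt] := feasible j.
apply/eqP; apply: contraT => ij.
have : coord_facet i (v + t *: b j).
  by split=> //; rewrite addrC addKr dotZr dual (negPf ij) mulr0.
rewrite eqF => -[_]; rewrite addrC addKr dotZr dual eqxx mulr1 => t0'.
by rewrite t0' ltxx in t0.
Qed.

Lemma card_facets_at_vertex :
  ([set F : set (vec R E) | facet P F /\ F v] #= `I_d)%card.
Proof.
have -> : [set F : set (vec R E) | facet P F /\ F v]%classic =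
          [set coord_facet i | i in [set: 'I_d]]%classic.
  apply/seteqP; split=> [F [hF Fv]|_ [i _ <-]].
    by have [i ->] := facet_coord_facet hF Fv; exists i.
  by split; [exact: coord_facet_facet|exact: coord_facet_vertex].
apply: card_eq_trans (_ : [set: 'I_d]%classic #= _)%card.
  by apply: inj_card_eq => i j _ _; apply: coord_facet_inj.
by rewrite card_eq_sym card_II.
Qed.

End Simplicial.

(** * Normal fans *)

(** Both fans are indexed by functionals [w0], since each [w0] gives a nonempty face and every face
    arises so; it suffices to compare the cones with the same index. *)
Lemma normally_equivalentP (R : realType) (E : finType) (P Q : set (vec R E)) :
  (forall w, max_face P w !=set0)%classic ->
  (forall w, max_face Q w !=set0)%classic ->
  (forall w0 w, normal_cone P (max_face P w0) w <->
                normal_cone Q (max_face Q w0) w) ->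
  normally_equivalent P Q.
Proof.
move=> P0 Q0 PQ.
have eqN w : normal_cone P (max_face P w) = normal_cone Q (max_face Q w).
  by apply/seteqP; split=> w'; have [] := PQ w w'.
apply/seteqP; split=> N [F [_ [w ->]] ->].
  by exists (max_face Q w) => //; split=> //; exists w.
by exists (max_face P w) => //; split=> //; exists w.
Qed.

Lemma refining_nested_cone (R : realType) (E : finType) (f : {set E} -> R)
    (r : {ffun E -> 'I_#|E|}) (w : vec R E) :
  (forall x y, w y < w x -> (r x < r y)%N) -> nested_cone f r w.
Proof.
move=> r_mono S d _ _ dmin s sS; rewrite leNgt; apply/negP => /r_mono.
by rewrite ltnNge dmin.
Qed.

(** * Normal cones and simplicity of the flag base polytope *)

Section FlagBase.
Variables (R : realType) (E : finType) (f : {set E} -> R).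
Hypotheses (hf : polymatroid f) (hE : 0 < f [set: E]).
Implicit Types (w x z : vec R E) (r : {ffun E -> 'I_#|E|}).

Let g := flag_polymatroid f.
Let hg : polymatroid g := polymatroid_flag hf.

Lemma ground_inhabited : exists e : E, True.
Proof. by have [q _ _] := root_exists hf hE [ffun x => enum_rank x]; exists q. Qed.

Lemma max_face_greedy w r : injective r -> nested_cone f r w ->
  max_face (base_polytope g) w (greedy g r).
Proof.
move=> r_inj wC; split; first exact: base_greedy.
exact: nested_cone_optimal.
Qed.

Lemma max_face_base_nonempty w : (max_face (base_polytope g) w !=set0)%classic.
Proof.
have [e0 _] := ground_inhabited.
have [r [r_inj r_mono _]] := refining_rank w e0.
by exists (greedy g r); apply: max_face_greedy => //; apply: refining_nested_cone.
Qed.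

(** A convex combination of values at most the maximum attains it only if every term with nonzero
    weight does. *)
Lemma max_face_hull w x (c : {ffun E -> 'I_#|E|} -> R) :
  (forall r, 0 <= c r) -> (forall r, c r != 0 -> injective r) -> \sum_r c r = 1 ->
  x = \sum_r c r *: greedy g r -> max_face (base_polytope g) w x ->
  forall r, c r != 0 -> max_face (base_polytope g) w (greedy g r).
Proof.
move=> c0 ci c1 xE [bx xmax] r cr; split; first exact/(base_greedy hg)/ci.
have term_ge0 r' : 0 <= c r' * (dot w x - dot w (greedy g r')).
  have [->|cr'] := eqVneq (c r') 0; first by rewrite mul0r.
  by rewrite mulr_ge0 // subr_ge0 xmax //; apply/(base_greedy hg)/ci.
have sum0 : \sum_r c r * (dot w x - dot w (greedy g r)) = 0.
  under eq_bigr do rewrite mulrBr.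
  rewrite sumrB -mulr_suml c1 mul1r [in X in X - _]xE dot_sumr.
  by rewrite (eq_bigr _ (fun r _ => dotZr w (c r) (greedy g r))) subrr.
have /eqP := sum0; rewrite psumr_eq0 // => /allP/(_ r).
rewrite mem_index_enum => /(_ isT); rewrite mulf_eq0 (negPf cr) /= subr_eq0.
by move=> /eqP <-.
Qed.

(** The maximal face of [w0] is the hull of the greedy points of those [r] whose nested cone
    contains [w0]. The right-hand side refers only to flats and orders, so it can be matched with
    the nestohedron. *)
Lemma normal_cone_base w0 w :
  normal_cone (base_polytope g) (max_face (base_polytope g) w0) w <->
  forall r, injective r -> nested_cone f r w0 -> nested_cone f r w.
Proof.
split=> [wN r r_inj w0C|h x xF z bz].
  apply: optimal_nested_cone => // z bz.
  by apply: wN bz; apply: max_face_greedy.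
have [e0 _] := ground_inhabited.
have [c [c0 ci c1 xE]] := base_polytope_greedy_hull hg e0 xF.1.
rewrite [in leRHS]xE dot_sumr -[leLHS]mul1r -c1 mulr_suml.
apply: ler_sum => r _; rewrite dotZr.
have [->|cr] := eqVneq (c r) 0; first by rewrite !mul0r.
apply: ler_wpM2l => //; apply: nested_cone_optimal => //; first exact: ci.
apply: h (ci _ cr) _; apply: optimal_nested_cone; [by []|exact: ci|].
by have [] := max_face_hull c0 ci c1 xE xF cr.
Qed.

Lemma polytope_base : polytope (base_polytope g).
Proof.
have [e0 _] := ground_inhabited.
pose I := [set r : {ffun E -> 'I_#|E|} | injectiveb r].
exists [seq greedy g r | r in I]; apply/seteqP; split=> x.
  move=> /(base_polytope_greedy_hull hg e0)[c [c0 ci c1 ->]].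
  have cI r : r \notin I -> c r = 0.
    rewrite inE => /injectiveP rI; apply/eqP; apply: contraT => cr.
    by case: rI; apply: ci.
  exists #|I|, (fun i => greedy g (enum_val i)), (fun i => c (enum_val i)).
  split=> // [i||].
  - by apply/imageP; exists (enum_val i) => //; apply: enum_valP.
  - transitivity (\sum_(r in I) c r); first by rewrite [RHS]big_enum_val.
    by rewrite -c1 [RHS](bigID [in I]) /= [X in _ + X]big1 ?addr0.
  - transitivity (\sum_(r in I) c r *: greedy g r); last by rewrite [LHS]big_enum_val.
    rewrite [LHS](bigID [in I]) /= [X in _ + X]big1 ?addr0 // => r /cI ->.
    by rewrite scale0r.
move=> [n [p [c [pI c0 c1 ->]]]].
have bp i : base_polytope g (p i).
  have /imageP[r rI ->] := pI i; apply: base_greedy => //.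
  by apply/injectiveP; rewrite inE in rI.
apply/(base_polytopeP hg); split=> [A|].
  rewrite /mass dot_sumr -[leRHS]mul1r -c1 mulr_suml.
  apply: ler_sum => i _; rewrite dotZr ler_wpM2l //.
  by have [h _] := (base_polytopeP hg (p i)).1 (bp i); apply: h.
rewrite /mass dot_sumr -[RHS]mul1r -c1 mulr_suml.
apply: eq_bigr => i _; rewrite dotZr.
by have [_ <-] := (base_polytopeP hg (p i)).1 (bp i).
Qed.

(** Any greedy point of nonzero weight in a convex expression of [x] lies in the face, which is the
    single point [x]. *)
Lemma vertex_base_greedy x : vertex (base_polytope g) x ->
  exists2 r : {ffun E -> 'I_#|E|}, injective r & x = greedy g r.
Proof.
move=> [_ [w xF]]; have [e0 _] := ground_inhabited.
have xw : max_face (base_polytope g) w x by rewrite -xF.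
have [c [c0 ci c1 xE]] := base_polytope_greedy_hull hg e0 xw.1.
have [r cr] : exists r, c r != 0.
  apply: contrapT => /forallNP h; move: c1; rewrite big1 => [/eqP|r _].
    by rewrite eq_sym oner_eq0.
  by apply/eqP; apply: contraT => /h.
exists r; first exact: ci.
by have := max_face_hull c0 ci c1 xE xw cr; rewrite -xF => ->.
Qed.

Lemma simple_polytope_base : simple_polytope (base_polytope g).
Proof.
split; first exact: polytope_base.
have [e0 _] := ground_inhabited.
exists #|nonloops f|.-1 => [|_ /vertex_base_greedy[r r_inj ->]].
  have [r [r_inj _ _]] := refining_rank (fun=> 0 : R) e0.
  have [b [u [dual expand ge0 feas _]]] := greedy_tangent_basis hf hE r_inj.
  exact: has_dim_simplicial (base_greedy hg r_inj) dual expand feas.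
have [b [u [dual expand ge0 feas _]]] := greedy_tangent_basis hf hE r_inj.
exact: card_facets_at_vertex (base_greedy hg r_inj) dual expand ge0 feas.
Qed.

End FlagBase.

(** * Normal cones of the nestohedron *)

Section Nestohedron.
Variables (R : realType) (E : finType) (f : {set E} -> R) (y : {set E} -> R).
Hypothesis y_gt0 : forall S, S \in flat_complements f -> S != finset.set0 -> 0 < y S.
Implicit Types (w x z : vec R E) (r : {ffun E -> 'I_#|E|}) (S : {set E}).

Let U S := (S \in flat_complements f) && (S != finset.set0).
Let Q := nestohedron (flat_complements f) y.

Lemma simplex_std_basis S s : s \in S -> simplex S (std_basis R s).
Proof.
move=> sS; exists 1%N, (fun=> std_basis R s), (fun=> 1); split=> //.
- by exists s.
- by rewrite big_ord1.
- by rewrite big_ord1 scale1r.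
Qed.

Lemma simplex_coord S x : simplex S x ->
  [/\ forall e, 0 <= x e, forall e, e \notin S -> x e = 0 & \sum_e x e = 1].
Proof.
move=> [n [p [c [pS c0 c1 ->]]]].
have coord e : (\sum_(i < n) c i *: p i) e = \sum_(i < n) c i * (p i e : R).
  by rewrite sum_ffunE; apply: eq_bigr => i _; rewrite ffunE.
split=> [e|e eS|].
- rewrite coord sumr_ge0 // => i _; rewrite mulr_ge0 //.
  by have [s _ ->] := pS i; rewrite ffunE ler0n.
- rewrite coord big1 // => i _; have [s sS ->] := pS i.
  by rewrite ffunE; case: eqP sS eS => [<- ->//|]; rewrite mulr0.
- under eq_bigr do rewrite coord.
  rewrite exchange_big /= -[RHS]c1; apply: eq_bigr => i _.
  rewrite -mulr_sumr; have [s _ ->] := pS i.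
  rewrite (bigD1 s) //= big1 ?addr0 ?ffunE ?eqxx ?mulr1 // => e /negPf es.
  by rewrite ffunE es.
Qed.

Lemma dot_simplex_le S x w (m : R) : simplex S x ->
  (forall s, s \in S -> w s <= m) -> dot w x <= m.
Proof.
move=> /simplex_coord[x0 xS x1] wm; rewrite -[leRHS]mulr1 -x1 mulr_sumr.
apply: ler_sum => e _; have [eS|eS] := boolP (e \in S).
  by rewrite ler_wpM2r ?wm.
by rewrite xS // !mulr0.
Qed.

Lemma nestohedronP x : Q x <-> exists2 z : {set E} -> vec R E,
  forall S, U S -> simplex S (z S) & x = \sum_(S | U S) y S *: z S.
Proof.
split=> [[z hz ->]|[z hz ->]].
  have /choice[z' hz'] : forall S, exists z', U S -> simplex S z' /\ z S = y S *: z'.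
    by move=> S; have [/hz[z' ? ?]|_] := boolP (U S); [exists z'|exists 0].
  exists z' => [S /hz'[]//|]; apply: eq_bigr => S /hz'[_ ->] //.
by exists (fun S => y S *: z S) => // S US; exists (z S) => //; apply: hz.
Qed.

(* Exchanging a single summand preserves membership, so a point maximizes [w]
   only if each of its summands does. *)
Lemma nestohedron_summand_opt w (z : {set E} -> vec R E) :
  (forall S, U S -> simplex S (z S)) ->
  (forall x, Q x -> dot w x <= dot w (\sum_(S | U S) y S *: z S)) ->
  forall S s, U S -> s \in S -> w s <= dot w (z S).
Proof.
move=> hz zopt S s US sS.
have /zopt : Q (\sum_(T | U T) y T *: (if T == S then std_basis R s else z T)).
  apply/nestohedronP; exists (fun T => if T == S then std_basis R s else z T) => // T UT.
  by case: eqP => [->|_]; [apply: simplex_std_basis|apply: hz].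
rewrite (bigD1 S) // [in leRHS](bigD1 S) //= eqxx.
under eq_bigr => T /andP[_ /negPf ->] do [].
rewrite !dotDr lerD2r !dotZr dot_std_basis ler_pM2l //.
by case/andP: US; apply: y_gt0.
Qed.

Lemma nestohedron_opt w (z : {set E} -> vec R E) :
  (forall S s, U S -> s \in S -> w s <= dot w (z S)) ->
  forall x, Q x -> dot w x <= dot w (\sum_(S | U S) y S *: z S).
Proof.
move=> zopt x /nestohedronP[z' hz' ->]; rewrite !dot_sumr.
apply: ler_sum => S US; rewrite !dotZr ler_wpM2l //.
  by case/andP: (US) => h1 h2; apply/ltW/y_gt0.
apply: dot_simplex_le (hz' _ US) _ => s; exact: zopt.
Qed.

Lemma nested_point r (e0 : E) : exists2 a : {set E} -> E,
  forall S, U S -> a S \in S /\ forall s, s \in S -> (r (a S) <= r s)%N &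
  Q (\sum_(S | U S) y S *: std_basis R (a S)).
Proof.
have /choice[a aP] : forall S, exists d, U S ->
    d \in S /\ forall s, s \in S -> (r d <= r s)%N.
  (* Outside the index family the choice is the dummy value [e0]. *)
  move=> S; have [/andP[_ /set0Pn[e eS]]|_] := boolP (U S); last by exists e0.
  by case: (arg_minnP (fun d => r d : nat) eS) => d dS dmin; exists d.
exists a => //; apply/nestohedronP; exists (fun S => std_basis R (a S)) => // S.
by move=> /aP[aS _]; apply: simplex_std_basis.
Qed.

Lemma nested_point_opt w r (a : {set E} -> E) :
  (forall S, U S -> a S \in S /\ forall s, s \in S -> (r (a S) <= r s)%N) ->
  injective r ->
  nested_cone f r w <->
  (forall x, Q x -> dot w x <= dot w (\sum_(S | U S) y S *: std_basis R (a S))).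
Proof.
move=> aP r_inj; split=> [wC|opt S d hS dS dmin s sS].
  apply: nestohedron_opt => S s US sS; rewrite dot_std_basis.
  by have [aS amin] := aP S US; apply: wC sS; case/andP: US.
have US : U S by rewrite /U hS; apply/set0Pn; exists d.
have [aS amin] := aP S US.
have -> : d = a S by apply/r_inj/val_inj/eqP; rewrite eqn_leq dmin //= amin.
rewrite -(dot_std_basis w (a S)).
apply: (@nestohedron_summand_opt w (fun S => std_basis R (a S))) => // T UT.
by apply: simplex_std_basis; have [] := aP T UT.
Qed.

Lemma max_face_nestohedron_nonempty w (e0 : E) : (max_face Q w !=set0)%classic.
Proof.
have [r [r_inj r_mono _]] := refining_rank w e0.
have [a aP Qa] := nested_point r e0.
by eexists; split; [exact: Qa|apply/(nested_point_opt w aP r_inj)/refining_nested_cone].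
Qed.

(** For the converse, each [e] in the support of the summand at [S] maximizes [w0] on [S]; some
    order refining [w0] then has [e] first in [S], so its nested cone bounds [w] on [S] by [w e]. *)
Lemma normal_cone_nestohedron w0 w (e0 : E) :
  normal_cone Q (max_face Q w0) w <->
  forall r, injective r -> nested_cone f r w0 -> nested_cone f r w.
Proof.
split=> [wN r r_inj w0C|h x [Qx xmax]].
  have [a aP Qa] := nested_point r e0.
  apply/(nested_point_opt w aP r_inj) => z Qz; apply: wN Qz; split=> //.
  exact/(nested_point_opt w0 aP r_inj).
have /nestohedronP[z hz xE] := Qx; rewrite xE in xmax *.
have opt0 := nestohedron_summand_opt hz xmax.
apply: nestohedron_opt => S s US sS.
have [z0 zS z1] := simplex_coord (hz S US).
(* The average of [w0] with weights [z S] equals its maximum on [S], so the nonnegative terms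
   [(w0 m - w0 e') * z S e'] all vanish. *)
have supp e : e \in S -> z S e != 0 -> forall t, t \in S -> w0 t <= w0 e.
  move=> eS ze; case: (arg_maxP w0 eS) => m mS mmax t tS.
  apply: (le_trans (mmax t tS)).
  have ge0 e' : 0 <= (w0 m - w0 e') * (z S e' : R).
    have [/mmax le_m|/zS ->] := boolP (e' \in S); last by rewrite mulr0.
    by rewrite mulr_ge0 ?subr_ge0.
  have : \sum_e' (w0 m - w0 e') * (z S e' : R) <= 0.
    under eq_bigr do rewrite mulrBl.
    by rewrite sumrB -mulr_sumr z1 mulr1 subr_le0; apply: opt0.
  move=> le0; have /eqP : \sum_e' (w0 m - w0 e') * (z S e' : R) = 0.
    by apply/eqP; rewrite eq_le le0 sumr_ge0.
  rewrite psumr_eq0 // => /allP/(_ e); rewrite mem_index_enum => /(_ isT).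
  by rewrite mulf_eq0 (negPf ze) orbF subr_eq0 => /eqP ->.
rewrite -[leLHS]mulr1 -z1 mulr_sumr; apply: ler_sum => e _.
have [->|ze] := eqVneq (z S e) 0; first by rewrite !mulr0.
have eS : e \in S by apply: contraT => /zS /eqP; rewrite (negPf ze).
rewrite ler_wpM2r //.
(* Ties are broken in favour of [e], so that it precedes all other maximizers of [w0] in [S]. *)
have [r [r_inj r_mono rmin]] := refining_rank w0 e.
apply: (h r r_inj (refining_nested_cone r_mono) S e) => //; first by case/andP: US.
move=> t tS; have := supp e eS ze t tS; rewrite le_eqVlt => /orP[/eqP/rmin//|/r_mono].
exact: ltnW.
Qed.

End Nestohedron.

Theorem theoremC (R : realType) (E : finType) (f : {set E} -> R)
    (hf : polymatroid f) (hE : 0 < f [set: E]%SET) :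
  [/\ polymatroid (flag_polymatroid f),
      building_set (flat_complements f),
      forall y : {set E} -> R,
        (forall S, S \in flat_complements f -> S != finset.set0 -> 0 < y S) ->
        normally_equivalent (base_polytope (flag_polymatroid f))
                            (nestohedron (flat_complements f) y) &
      simple_polytope (base_polytope (flag_polymatroid f))].
Proof.
split.
- exact: polymatroid_flag.
- exact: building_set_flat_complements.
- move=> y y0; have [e0 _] := ground_inhabited hf hE.
  apply: normally_equivalentP => [w|w|w0 w].
  + exact: max_face_base_nonempty.
  + exact: max_face_nestohedron_nonempty.
  + exact: iff_trans (normal_cone_base hf hE w0 w)
      (iff_sym (normal_cone_nestohedron y0 w0 w e0)).
- exact: simple_polytope_base.
Qed.
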